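(* Consider any one of the three accelerated ADMM-based algorithms (accelerated ADMM, accelerated OSQP, accelerated SCS) defined in the context, with hyperparameters $\theta=(\alpha^0,\beta^0,\dots,\alpha^{K-1},\beta^{K-1},\theta^{\rm inv})$ such that $\theta^{\rm inv}>0$ componentwise, and let $\mathcal X\subseteq\mathbf{R}^d$ be a set of parameters. Let $R(\theta^{\rm inv})\in\mathbf{R}^{n\times n}$ be the symmetric positive definite matrix and $S_{\theta^{\rm inv}}:\mathbf{R}^n\times\mathbf{R}^d\to\mathbf{R}^n$ the operator, nonexpansive in its first argument with respect to $R(\theta^{\rm inv})$, for which the iterates of the algorithm satisfy, for all $x\in\mathcal X$ and $k=0,\dots,K-1$, $$y^{k+1}_\theta(x)=(\alpha^k/2)S_{\theta^{\rm inv}}(z^k_\theta(x),x)+(1-\alpha^k/2)z^k_\theta(x),\qquad z^{k+1}_\theta(x)=y^{k+1}_\theta(x)+\beta^k(y^{k+1}_\theta(x)-y^k_\theta(x)),$$ with $y^0(x)=z^0(x)$. Assume that for all $x\in\mathcal X$ there exists a fixed point $z^\star(x)=S_{\theta^{\rm inv}}(z^\star(x),x)$. Then, for the optimal value $\gamma(\theta)$ of the semidefinite program defined in the context, $$\|z^K_\theta(x)-S_{\theta^{\rm inv}}(z^K_\theta(x),x)\|_{R(\theta^{\rm inv})}^2\le\gamma(\theta)\,\|z^0(x)-z^\star(x)\|_{R(\theta^{\rm inv})}^2\qquad\text{for all }x\in\mathcal X.$$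
   Context: For a symmetric positive definite $R$, $\|v\|_R=\sqrt{v^TRv}$; an operator $T$ is nonexpansive with respect to $R$ if $\|Tu-Tv\|_R\le\|u-v\|_R$ for all $u,v$ in its domain. For a function $h$, $\mathrm{prox}_h(v)=\arg\min_u h(u)+\tfrac12\|u-v\|_2^2$. $\Pi_C$ is Euclidean projection; $\mathbf 1_r$ is the all-ones vector; $\mathrm{diag}(v)$ is the diagonal matrix with diagonal $v$. SDP. Let $e^1,\dots,e^{K+4}$ be the standard basis of $\mathbf{R}^{K+4}$ and $a^{\otimes2}=aa^T$. The symmetric matrix $G\in\mathbf{R}^{(K+4)\times(K+4)}$ models the Gram matrix $P^TP$ of the columns $P=\big(R^{1/2}z^0,\ R^{1/2}z^\star,\ R^{1/2}S(z^0),\dots,R^{1/2}S(z^K),\ R^{1/2}S(z^\star)\big)$. Define $\sigma^k=e^{3+k}$ ($0\le k\le K$), $\sigma^\star=e^{K+4}$, $\rho^\star=e^2$, $\rho^0=\eta^0=e^1$, and for $0\le k\le K-1$ $$\eta^{k+1}=(1-\alpha^k/2)\rho^k+(\alpha^k/2)\sigma^k,\qquad \rho^{k+1}=\eta^{k+1}+\beta^k(\eta^{k+1}-\eta^k).$$ (So $\rho^k,\eta^k,\sigma^k$ represent $z^k,y^k,S(z^k)$.) Let $U=(\rho^K-\sigma^K)^{\otimes2}$, $A^0=(e^1-e^2)^{\otimes2}$, $A^\star=(e^2-e^{K+4})^{\otimes2}$, $B^{ij}=(\sigma^i-\sigma^j)^{\otimes2}-(\rho^i-\rho^j)^{\otimes2}$.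 The SDP is: maximize $\mathrm{Tr}(GU)$ over symmetric $G$ subject to $\mathrm{Tr}(GA^0)\le1$, $\mathrm{Tr}(GA^\star)=0$, $\mathrm{Tr}(GB^{ij})\le0$ for all $i,j\in\{0,\dots,K,\star\}$, and $G\succeq0$. Its optimal value is a supremum (possibly $+\infty$, in which case the bound is vacuous). Algorithms. The time-varying weights are $\alpha^k,\beta^k\in\mathbf{R}$. All problem data are determined by $x$; dimensions and the partition of constraints/cones are fixed for the family. For each algorithm and $\theta^{\rm inv}>0$, a pair $R(\theta^{\rm inv}),S_{\theta^{\rm inv}}$ as in the claim exists. (i) Accelerated ADMM (in Douglas–Rachford form), for $\min_w f(w,x)+g(w,x)$ with $f(\cdot,x),g(\cdot,x):\mathbf{R}^q\to\mathbf{R}\cup\{+\infty\}$ closed, convex, proper; $\theta^{\rm inv}=(\eta)$, $n=q$ (this scalar $\eta$ is unrelated to the vectors $\eta^k$ above): $w^{k+1}=\mathrm{prox}_{\eta f}(z^k)$, $\tilde w^{k+1}=\mathrm{prox}_{\eta g}(2w^{k+1}-z^k)$, $y^{k+1}=z^k+\alpha^k(\tilde w^{k+1}-w^{k+1})$, $z^{k+1}=y^{k+1}+\beta^k(y^{k+1}-y^k)$. (ii) Accelerated OSQP, for $\min_w\tfrac12w^TPw+c^Tw$ subject to $l\le Aw\le u$, with $x=(P,A,c,l,u)$, $P\in\mathbf{R}^{p\times p}$ symmetric positive semidefinite, $A\in\mathbf{R}^{m\times p}$, $c\in\mathbf{R}^p$, $l,u\in\mathbf{R}^m$, $l\le u$;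 $\theta^{\rm inv}=(\sigma,\rho_{\rm eq},\rho_{\rm ineq})$, $\rho=(\rho_{\rm eq}\mathbf 1_{m_{\rm eq}},\rho_{\rm ineq}\mathbf 1_{m_{\rm ineq}})\in\mathbf{R}^m$, where $m_{\rm eq}$ counts the constraints with $l_i=u_i$ (listed first) and $m_{\rm ineq}$ those with $l_i<u_i$; $n=p+m$. With $z^k=(w^k,\xi^k)\in\mathbf{R}^p\times\mathbf{R}^m$ and $Q=P+\sigma I+A^T\mathrm{diag}(\rho)A$: $v^{k+1}=\Pi_{[l,u]}(\xi^k)$; $\tilde w^{k+1}$ solves $Q\tilde w^{k+1}=\sigma w^k-c+A^T\mathrm{diag}(\rho)(2v^{k+1}-\xi^k)$; $\tilde\xi^{k+1}=A\tilde w^{k+1}+\xi^k-v^{k+1}$; $y^{k+1}=(w^k+\alpha^k(\tilde w^{k+1}-w^k),\ \xi^k+\alpha^k(\tilde\xi^{k+1}-\xi^k))$; $z^{k+1}=y^{k+1}+\beta^k(y^{k+1}-y^k)$. (iii) Accelerated SCS, for $\min_{w,s}\tfrac12w^TPw+c^Tw$ subject to $Aw+s=b$, $s\in\mathcal K$, with $x=(P,A,c,b)$, $P\in\mathbf{R}^{p\times p}$ symmetric positive semidefinite, $A\in\mathbf{R}^{m\times p}$, $c\in\mathbf{R}^p$, $b\in\mathbf{R}^m$, and $\mathcal K=\{0\}^{m_{\rm z}}\times\mathcal K_{\rm nz}\subseteq\mathbf{R}^m$ a nonempty closed convex cone with dual cone $\mathcal K^*=\{w\mid w^Tz\ge0\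 \forall z\in\mathcal K\}$, $m=m_{\rm z}+m_{\rm nz}$; $\theta^{\rm inv}=(r_w,r_{y_{\rm z}},r_{y_{\rm nz}})$, $n=p+m$. With $D=\mathrm{diag}(r_w\mathbf 1_p,r_{y_{\rm z}}\mathbf 1_{m_{\rm z}},r_{y_{\rm nz}}\mathbf 1_{m_{\rm nz}})$, $M=\begin{bmatrix}I_p+P&A^T\\-A&I_m\end{bmatrix}$, $q=(c,b)$: $\tilde u^{k+1}$ solves $(D+M)\tilde u^{k+1}=Dz^k-q$; $u^{k+1}=\Pi_{\mathbf{R}^p\times\mathcal K^*}(2\tilde u^{k+1}-z^k)$; $y^{k+1}=z^k+\alpha^k(u^{k+1}-\tilde u^{k+1})$; $z^{k+1}=y^{k+1}+\beta^k(y^{k+1}-y^k)$. *)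

(* Defs.v *)
From mathcomp Require Import all_boot all_order all_algebra.
From mathcomp Require Import all_classical all_reals all_analysis.
Set Implicit Arguments.
Unset Strict Implicit.
Unset Printing Implicit Defensive.
Import Order.TTheory GRing.Theory Num.Theory.
Import numFieldNormedType.Exports.
Local Open Scope classical_set_scope.
Local Open Scope ring_scope.

Section Matrices.
Context {R : realType}.

Definition qform n (M : 'M[R]_n) (v : 'cV[R]_n) : R := (v^T *m M *m v) 0 0.

Definition posdef n (M : 'M[R]_n) : Prop :=
  M^T = M /\ forall v : 'cV[R]_n, v != 0 -> 0 < qform M v.

Definition possemidef n (M : 'M[R]_n) : Prop :=
  M^T = M /\ forall v : 'cV[R]_n, 0 <= qform M v.

Definition wnorm n (M : 'M[R]_n) (v : 'cV[R]_n) : R := Num.sqrt (qform M v).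

(* The library norm on matrices is the sup norm, hence this definition. *)
Definition norm2 n (v : 'cV[R]_n) : R := Num.sqrt ((v^T *m v) 0 0).

Definition nonexpansive n (M : 'M[R]_n) (T : 'cV[R]_n -> 'cV[R]_n) : Prop :=
  forall u v, wnorm M (T u - T v) <= wnorm M (u - v).

(* The default value 0 of [xget] is irrelevant whenever the system is
   solvable. *)
Definition solution n (M : 'M[R]_n) (b : 'cV[R]_n) : 'cV[R]_n :=
  xget 0 [set w | M *m w = b].

End Matrices.

Section ProxProj.
Context {R : realType} {n : nat}.

Definition argmin (h : 'cV[R]_n -> \bar R) : set 'cV[R]_n :=
  [set u | forall v, (h u <= h v)%E].

(* [prox] and [euclid_proj] select an element of the set of minimizers, and are 0
   when this set is empty; for closed convex proper [h], resp. nonempty closed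
   convex [C], this set is a singleton. *)
Definition prox (h : 'cV[R]_n -> \bar R) (v : 'cV[R]_n) : 'cV[R]_n :=
  xget 0 (argmin (fun u => h u + (2^-1 * norm2 (u - v) ^+ 2)%:E)%E).

Definition euclid_proj (C : set 'cV[R]_n) (v : 'cV[R]_n) : 'cV[R]_n :=
  xget 0 [set u | C u /\ forall u', C u' -> norm2 (u - v) <= norm2 (u' - v)].

Definition convex_fct (h : 'cV[R]_n -> \bar R) : Prop :=
  forall (u v : 'cV[R]_n) (t : R), 0 < t < 1 ->
    (h (t *: u + (1 - t) *: v)%R <= t%:E * h u + (1 - t)%:E * h v)%E.

Definition closed_fct (h : 'cV[R]_n -> \bar R) : Prop :=
  closed [set wt : 'cV[R]_n * R | (h wt.1 <= wt.2%:E)%E].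

(* The first component says that [h] takes its values in R \cup {+oo}. *)
Definition proper_fct (h : 'cV[R]_n -> \bar R) : Prop :=
  (forall w, h w != -oo%E) /\ exists w, (h w < +oo)%E.

Definition ccp_fct (h : 'cV[R]_n -> \bar R) : Prop :=
  [/\ closed_fct h, convex_fct h & proper_fct h].

Definition box (l u : 'cV[R]_n) : set 'cV[R]_n :=
  [set v | forall i, l i 0 <= v i 0 <= u i 0].

Definition dual_cone (C : set 'cV[R]_n) : set 'cV[R]_n :=
  [set w | forall z, C z -> 0 <= (w^T *m z) 0 0].

Definition closed_convex_cone (C : set 'cV[R]_n) : Prop :=
  [/\ C !=set0, closed C,
      (forall (u v : 'cV[R]_n) (t : R), C u -> C v -> 0 <= t <= 1 ->
         C (t *: u + (1 - t) *: v)) &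
      (forall (u : 'cV[R]_n) (t : R), C u -> 0 <= t -> C (t *: u))].

End ProxProj.

(* One half-step z^k |-> y^{k+1} of each of the three algorithms, for one
   problem instance; [al] stands for alpha^k. *)
Section HalfSteps.
Context {R : realType}.

Definition admm_half q (eta : R) (f g : 'cV[R]_q -> \bar R)
    (al : R) (z : 'cV[R]_q) : 'cV[R]_q :=
  let w := prox (fun u => eta%:E * f u)%E z in
  let wt := prox (fun u => eta%:E * g u)%E (2 *: w - z) in
  z + al *: (wt - w).

Definition osqp_rho meq mineq (rho_eq rho_ineq : R) : 'cV[R]_(meq + mineq) :=
  col_mx (const_mx rho_eq) (const_mx rho_ineq).

Definition osqp_half p meq mineq (sigma rho_eq rho_ineq : R)
    (P : 'M[R]_p) (A : 'M[R]_(meq + mineq, p)) (c : 'cV[R]_p)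
    (l u : 'cV[R]_(meq + mineq))
    (al : R) (z : 'cV[R]_(p + (meq + mineq))) : 'cV[R]_(p + (meq + mineq)) :=
  let w := usubmx z in
  let xi := dsubmx z in
  let Drho := diag_mx (osqp_rho meq mineq rho_eq rho_ineq)^T in
  let Q := P + sigma%:M + A^T *m Drho *m A in
  let v := euclid_proj (box l u) xi in
  let wt := solution Q (sigma *: w - c + A^T *m Drho *m (2 *: v - xi)) in
  let xit := A *m wt + xi - v in
  col_mx (w + al *: (wt - w)) (xi + al *: (xit - xi)).

Definition scs_cone mz mnz (Knz : set 'cV[R]_mnz) : set 'cV[R]_(mz + mnz) :=
  [set s | usubmx s = 0 /\ Knz (dsubmx s)].

Definition scs_half p mz mnz (r_w r_yz r_ynz : R)
    (P : 'M[R]_p) (A : 'M[R]_(mz + mnz, p)) (c : 'cV[R]_p)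
    (b : 'cV[R]_(mz + mnz)) (Knz : set 'cV[R]_mnz)
    (al : R) (z : 'cV[R]_(p + (mz + mnz))) : 'cV[R]_(p + (mz + mnz)) :=
  let D := diag_mx (col_mx (const_mx r_w : 'cV[R]_p)
             (col_mx (const_mx r_yz : 'cV[R]_mz)
                     (const_mx r_ynz : 'cV[R]_mnz)))^T in
  let M := block_mx (1%:M + P) A^T (- A) 1%:M in
  let q := col_mx c b in
  let ut := solution (D + M) (D *m z - q) in
  let C := [set v : 'cV[R]_(p + (mz + mnz)) |
              dual_cone (@scs_cone mz mnz Knz) (dsubmx v)] in
  let u := euclid_proj C (2 *: ut - z) in
  z + al *: (u - ut).

End HalfSteps.

(* An algorithm together with its parameters theta^inv and a family of problem
   instances whose data are functions of the parameter x in R^d; dimensions,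
   the equality/inequality partition and the cone do not depend on x. *)
Inductive algorithm (R : realType) (d : nat) : Type :=
| ADMM (q : nat) (eta : R) (f g : 'cV[R]_q -> 'cV[R]_d -> \bar R)
| OSQP (p meq mineq : nat) (sigma rho_eq rho_ineq : R)
    (P : 'cV[R]_d -> 'M[R]_p) (A : 'cV[R]_d -> 'M[R]_(meq + mineq, p))
    (c : 'cV[R]_d -> 'cV[R]_p) (l u : 'cV[R]_d -> 'cV[R]_(meq + mineq))
| SCS (p mz mnz : nat) (r_w r_yz r_ynz : R)
    (P : 'cV[R]_d -> 'M[R]_p) (A : 'cV[R]_d -> 'M[R]_(mz + mnz, p))
    (c : 'cV[R]_d -> 'cV[R]_p) (b : 'cV[R]_d -> 'cV[R]_(mz + mnz))
    (Knz : set 'cV[R]_mnz).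

Section Algorithms.
Context {R : realType} {d : nat}.

Definition theta_inv_pos (a : algorithm R d) : Prop :=
  match a with
  | ADMM _ eta _ _ => 0 < eta
  | OSQP _ _ _ sigma rho_eq rho_ineq _ _ _ _ _ =>
      [/\ 0 < sigma, 0 < rho_eq & 0 < rho_ineq]
  | SCS _ _ _ r_w r_yz r_ynz _ _ _ _ _ =>
      [/\ 0 < r_w, 0 < r_yz & 0 < r_ynz]
  end.

Definition valid_data (X : set 'cV[R]_d) (a : algorithm R d) : Prop :=
  match a with
  | ADMM _ _ f g =>
      forall x, X x -> ccp_fct (f ^~ x) /\ ccp_fct (g ^~ x)
  | OSQP _ meq _ _ _ _ P _ _ l u =>
      forall x, X x -> possemidef (P x) /\
        forall i, l x i 0 <= u x i 0 /\ (l x i 0 = u x i 0 <-> (i < meq)%N)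
  | SCS _ mz _ _ _ _ P _ _ _ Knz =>
      closed_convex_cone (@scs_cone R mz _ Knz) /\
      forall x, X x -> possemidef (P x)
  end.

Definition alg_dim (a : algorithm R d) : nat :=
  match a with
  | ADMM q _ _ _ => q
  | OSQP p meq mineq _ _ _ _ _ _ _ _ => p + (meq + mineq)
  | SCS p mz mnz _ _ _ _ _ _ _ _ => p + (mz + mnz)
  end.

Definition half_step (a : algorithm R d) (x : 'cV[R]_d) :
    R -> 'cV[R]_(alg_dim a) -> 'cV[R]_(alg_dim a) :=
  match a return R -> 'cV[R]_(alg_dim a) -> 'cV[R]_(alg_dim a) with
  | ADMM _ eta f g => admm_half eta (f ^~ x) (g ^~ x)
  | OSQP _ _ _ sigma rho_eq rho_ineq P A c l u =>
      osqp_half sigma rho_eq rho_ineq (P x) (A x) (c x) (l x) (u x)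
  | SCS _ _ _ r_w r_yz r_ynz P A c b Knz =>
      scs_half r_w r_yz r_ynz (P x) (A x) (c x) (b x) Knz
  end.

(* The pair (y^k, z^k) started from y^0 = z^0 = [z0]. *)
Fixpoint iterates (a : algorithm R d) (alpha beta : nat -> R) (x : 'cV[R]_d)
    (z0 : 'cV[R]_(alg_dim a)) (k : nat) : 'cV[R]_(alg_dim a) * 'cV[R]_(alg_dim a) :=
  if k is k'.+1 then
    let yz := iterates alpha beta x z0 k' in
    let y' := half_step x (alpha k') yz.2 in
    (y', y' + beta k' *: (y' - yz.1))
  else (z0, z0).

Definition yiter (a : algorithm R d) alpha beta (z0 : 'cV[R]_d -> 'cV[R]_(alg_dim a))
    x k := (iterates alpha beta x (z0 x) k).1.

Definition ziter (a : algorithm R d) alpha beta (z0 : 'cV[R]_d -> 'cV[R]_(alg_dim a))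
    x k := (iterates alpha beta x (z0 x) k).2.

(* Only alpha^0, beta^0, ..., alpha^{K-1}, beta^{K-1} matter here and in the
   semidefinite program below, although [alpha] and [beta] are indexed by nat. *)
Definition fixed_point_form (X : set 'cV[R]_d) (a : algorithm R d) (K : nat)
    (alpha beta : nat -> R) (z0 : 'cV[R]_d -> 'cV[R]_(alg_dim a))
    (S : 'cV[R]_(alg_dim a) -> 'cV[R]_d -> 'cV[R]_(alg_dim a)) : Prop :=
  let y := yiter alpha beta z0 in
  let z := ziter alpha beta z0 in
  forall x k, X x -> (k < K)%N ->
    y x k.+1 = (alpha k / 2) *: S (z x k) x + (1 - alpha k / 2) *: z x k /\
    z x k.+1 = y x k.+1 + beta k *: (y x k.+1 - y x k).

End Algorithms.

Section SDP.
Context {R : realType} (K : nat) (alpha beta : nat -> R).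

(* Standard basis numbered from 1: [ebas i] is e^i, for 1 <= i <= K + 4. *)
Definition ebas (i : nat) : 'cV[R]_(K.+4) := delta_mx (inord i.-1) 0.

Definition tens2 (a : 'cV[R]_(K.+4)) : 'M[R]_(K.+4) := a *m a^T.

Definition sdp_sigma (k : nat) : 'cV[R]_(K.+4) := ebas (3 + k).

(* The pair (eta^k, rho^k). *)
Fixpoint sdp_eta_rho (k : nat) : 'cV[R]_(K.+4) * 'cV[R]_(K.+4) :=
  if k is k'.+1 then
    let er := sdp_eta_rho k' in
    let eta' := (1 - alpha k' / 2) *: er.2 + (alpha k' / 2) *: sdp_sigma k' in
    (eta', eta' + beta k' *: (eta' - er.1))
  else (ebas 1, ebas 1).

Definition sdp_rho (k : nat) : 'cV[R]_(K.+4) := (sdp_eta_rho k).2.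

(* [None] stands for the index star. *)
Definition sdp_sigma_star (i : option 'I_K.+1) : 'cV[R]_(K.+4) :=
  if i is Some k then sdp_sigma k else ebas K.+4.

Definition sdp_rho_star (i : option 'I_K.+1) : 'cV[R]_(K.+4) :=
  if i is Some k then sdp_rho k else ebas 2.

Definition sdp_U : 'M[R]_(K.+4) := tens2 (sdp_rho K - sdp_sigma K).
Definition sdp_A0 : 'M[R]_(K.+4) := tens2 (ebas 1 - ebas 2).
Definition sdp_Astar : 'M[R]_(K.+4) := tens2 (ebas 2 - ebas K.+4).
Definition sdp_B (i j : option 'I_K.+1) : 'M[R]_(K.+4) :=
  tens2 (sdp_sigma_star i - sdp_sigma_star j)
  - tens2 (sdp_rho_star i - sdp_rho_star j).

Definition sdp_feasible : set 'M[R]_(K.+4) :=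
  [set G | [/\ \tr (G *m sdp_A0) <= 1, \tr (G *m sdp_Astar) = 0,
               (forall i j, \tr (G *m sdp_B i j) <= 0) & possemidef G]].

(* Never -oo, since [G = 0] is feasible. *)
Definition sdp_value : \bar R :=
  ereal_sup [set (\tr (G *m sdp_U))%:E | G in sdp_feasible].

End SDP.

(* Main.v *)
Require Import Defs.
From mathcomp Require Import all_boot all_order all_algebra.
From mathcomp Require Import all_classical all_reals all_analysis.
From mathcomp Require Import ring lra.
Set Implicit Arguments.
Unset Strict Implicit.
Unset Printing Implicit Defensive.
Import Order.TTheory GRing.Theory Num.Theory.
Import numFieldNormedType.Exports.
Local Open Scope classical_set_scope.
Local Open Scope ring_scope.

(** Each algorithm has the form [y = (1 - al) z + al T z] for a map [T], namely
    its half-step with weight 1, which does not depend on [al], so that the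
    operator is [S = 2 T - id].  For ADMM, [S] is a composition of two reflected
    proximal maps.  For OSQP, [T] is firmly nonexpansive for the metric
    [diag(sigma, rho)], because the projection onto a box is monotone
    coordinatewise.  For SCS, [S] is a composition of the reflected resolvent of
    the monotone map [M] and the reflected projection, both for the metric [D],
    which is scalar on the only block that the cone constrains.

    For the bound, let [P] have columns [z^0, zs, S z^0, ..., S z^K, S zs] and
    [c = |z^0 - zs|_R^2].  If [c > 0], the Gram matrix [P^T R P / c] is feasible
    for the semidefinite program, since [P] maps the formal vectors [rho^k],
    [eta^k], [sigma^k] to [z^k], [y^k], [S z^k], and its objective value is the
    squared residual divided by [c].  If [c = 0], all the iterates equal [zs]. *)

(** * Quadratic forms *)

Section BilinearForm.
Context {R : realType} {n : nat}.
Implicit Types (M : 'M[R]_n) (u v w : 'cV[R]_n).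

Definition mdot M u v : R := (u^T *m M *m v) 0 0.

Lemma mdotDl M u v w : mdot M (u + v) w = mdot M u w + mdot M v w.
Proof. by rewrite /mdot linearD /= !mulmxDl mxE. Qed.

Lemma mdotDr M u v w : mdot M w (u + v) = mdot M w u + mdot M w v.
Proof. by rewrite /mdot mulmxDr mxE. Qed.

Lemma mdotZl M t u v : mdot M (t *: u) v = t * mdot M u v.
Proof. by rewrite /mdot linearZ /= -!scalemxAl mxE. Qed.

Lemma mdotZr M t u v : mdot M u (t *: v) = t * mdot M u v.
Proof. by rewrite /mdot -scalemxAr mxE. Qed.

Lemma mdotNl M u v : mdot M (- u) v = - mdot M u v.
Proof. by rewrite -scaleN1r mdotZl mulN1r. Qed.

Lemma mdotNr M u v : mdot M u (- v) = - mdot M u v.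
Proof. by rewrite -scaleN1r mdotZr mulN1r. Qed.

Definition mdotE := (mdotDl, mdotDr, mdotNl, mdotNr, mdotZl, mdotZr).

Lemma mdotC M u v : M^T = M -> mdot M u v = mdot M v u.
Proof.
move=> sM; rewrite /mdot -[in LHS](trmxK (u^T *m M *m v)) mxE.
by rewrite !trmx_mul trmxK sM mulmxA.
Qed.

Lemma mdot_add_mx M N u v : mdot (M + N) u v = mdot M u v + mdot N u v.
Proof. by rewrite /mdot mulmxDr mulmxDl mxE. Qed.

Lemma qformE M v : qform M v = mdot M v v.
Proof. by []. Qed.

Lemma qform0 M : qform M 0 = 0.
Proof. by rewrite /qform mulmx0 mxE. Qed.

Lemma norm2_sq v : norm2 v ^+ 2 = mdot 1%:M v v.
Proof.
rewrite /norm2 /mdot mulmx1 sqr_sqrtr // mxE.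
by apply: sumr_ge0 => i _; rewrite mxE -expr2 sqr_ge0.
Qed.

Lemma posdef_possemidef M : posdef M -> possemidef M.
Proof.
move=> [sM pM]; split=> // v.
have [->|/pM/ltW//] := eqVneq v 0.
by rewrite qform0.
Qed.

Lemma wnorm_sq M v : possemidef M -> wnorm M v ^+ 2 = qform M v.
Proof. by move=> [_ pM]; rewrite /wnorm sqr_sqrtr. Qed.

(** Stated without symmetry because the SCS system matrix has a skew part. A row vector [r] in the
    left kernel makes the form vanish at its transpose. *)
Lemma posdef_unit M : (forall v, v != 0 -> 0 < qform M v) -> M \in unitmx.
Proof.
move=> pM; rewrite -row_free_unit -kermx_eq0.
apply/negP => /negP/rowV0Pn[r /sub_kermxP rM].
rewrite -(inj_eq (@trmx_inj _ _ _)) trmx0 => /pM.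
by rewrite /qform trmxK rM mul0mx mxE ltxx.
Qed.

Lemma solutionP M b : M \in unitmx -> M *m solution M b = b.
Proof.
move=> uM; apply: (@xgetPex _ 0 [set w | M *m w = b]).
by exists (invmx M *m b); rewrite /= mulKVmx.
Qed.

(** Expanding, [qform M (2 *: t - z)] is [qform M z] minus four times [mdot M t (z - t)]. *)
Lemma qform_reflect_le M t z : M^T = M -> 0 <= mdot M t (z - t) ->
  qform M (2 *: t - z) <= qform M z.
Proof.
move=> sM; rewrite !qformE !mdotE (mdotC z t sM) => h.
lra.
Qed.

End BilinearForm.

Lemma trace_mul_outer {R : realType} n (M : 'M[R]_n) (u : 'cV[R]_n) :
  \tr (M *m (u *m u^T)) = qform M u.
Proof. by rewrite mulmxA mxtrace_mulC /qform trace_mx11 mulmxA. Qed.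

Lemma qform_congr {R : realType} m n (P : 'M[R]_(n, m)) (M : 'M[R]_n) u :
  qform (P^T *m M *m P) u = qform M (P *m u).
Proof. by rewrite /qform trmx_mul !mulmxA. Qed.

(** * The semidefinite program *)

Section SDPBound.
Context {R : realType} {n : nat} (K : nat) (alpha beta : nat -> R).
Variables (Rm : 'M[R]_n) (T : 'cV[R]_n -> 'cV[R]_n) (zs : 'cV[R]_n).
Variables (y z : nat -> 'cV[R]_n).
Hypothesis pR : posdef Rm.
Hypothesis nT : nonexpansive Rm T.
Hypothesis zsE : zs = T zs.
Hypothesis y0E : y 0 = z 0.
Hypothesis yS : forall k, (k < K)%N ->
  y k.+1 = (alpha k / 2) *: T (z k) + (1 - alpha k / 2) *: z k.
Hypothesis zS : forall k, (k < K)%N ->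
  z k.+1 = y k.+1 + beta k *: (y k.+1 - y k).

(** No square root of the metric is taken: the Gram matrix is formed as [P^T *m Rm *m P]. Columns
    are numbered from 0, so [T (z k)] sits in column [k + 2] and [T zs] in the last one, where [j'']
    is [K + 1]. *)
Definition gram_factor : 'M[R]_(n, K.+4) :=
  \matrix_(i, j) (if (j : nat) is j'.+1 then
                    if j' is j''.+1 then
                      if (j'' <= K)%N then T (z j'') else T zs
                    else zs
                  else z 0) i 0.

Lemma gram_factor_ebas i : (0 < i <= K.+4)%N ->
  gram_factor *m ebas K i = (if i.-1 is j'.+1 then
                    if j' is j''.+1 then
                      if (j'' <= K)%N then T (z j'') else T zs
                    else zs
                  else z 0).
Proof.
move=> /andP[i0 iK]; rewrite /ebas -colE.
apply/colP => j; rewrite !mxE inordK //.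
by case: i i0 iK.
Qed.

Lemma gram_factor_sigma k : (k <= K)%N -> gram_factor *m sdp_sigma K k = T (z k).
Proof.
move=> kK; rewrite /sdp_sigma !addSn add0n gram_factor_ebas /= ?kK //.
by rewrite !ltnS leqW.
Qed.

Lemma gram_factor_eta_rho k : (k <= K)%N ->
  gram_factor *m (sdp_eta_rho K alpha beta k).1 = y k /\
  gram_factor *m (sdp_eta_rho K alpha beta k).2 = z k.
Proof.
elim: k => [_|k IH kK] /=; first by rewrite gram_factor_ebas.
have [IHy IHz] := IH (ltnW kK).
have Ey : gram_factor *m ((1 - alpha k / 2) *: (sdp_eta_rho K alpha beta k).2 +
    (alpha k / 2) *: sdp_sigma K k) = y k.+1.
  rewrite mulmxDr -!scalemxAr IHz gram_factor_sigma ?(ltnW kK) //.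
  by rewrite yS // addrC.
split=> //; rewrite mulmxDr -scalemxAr mulmxBr Ey IHy zS //.
Qed.

Lemma residual_le_sdp :
  ((wnorm Rm (z K - T (z K)) ^+ 2)%:E
     <= sdp_value K alpha beta * (wnorm Rm (z 0 - zs) ^+ 2)%:E)%E.
Proof.
have sR := posdef_possemidef pR.
rewrite !wnorm_sq //.
have [z0s|z0s] := eqVneq (z 0) zs.
  have H k : (k <= K)%N -> y k = zs /\ z k = zs.
    elim: k => [_|k IH kK]; first by rewrite y0E z0s.
    have [IHy IHz] := IH (ltnW kK).
    have Ey : y k.+1 = zs.
      by rewrite yS // IHz -zsE -scalerDl addrC subrK scale1r.
    by rewrite zS // Ey IHy subrr scaler0 addr0.
  have [_ ->] := H K (leqnn K).
  (* The right-hand side is 0 by [mule0] even if the SDP value is [+oo], so the residual has to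
     vanish exactly. *)
  by rewrite z0s -zsE subrr qform0 mule0.
set c := qform Rm (z 0 - zs).
have c0 : 0 < c by apply: (pR.2); rewrite subr_eq0.
pose G := c^-1 *: (gram_factor^T *m Rm *m gram_factor).
have trG u : \tr (G *m tens2 u) = c^-1 * qform Rm (gram_factor *m u).
  by rewrite /G -scalemxAl linearZ /= trace_mul_outer qform_congr.
have cV : c^-1 * c = 1 by rewrite mulVf ?gt_eqF.
suff fG : sdp_feasible alpha beta G.
  have : ((\tr (G *m sdp_U K alpha beta))%:E <= sdp_value K alpha beta)%E.
    by apply: ereal_sup_ubound; exists G.
  move=> /(lee_wpmul2r (x := c%:E)); rewrite lee_fin ltW // => /(_ isT).
  apply: le_trans; rewrite -EFinM lee_fin trG mulmxBr gram_factor_sigma //.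
  have [_ ->] := gram_factor_eta_rho (leqnn K).
  by rewrite mulrAC cV mul1r.
(* Every index, star included, represents a pair [(w, T w)], so each constraint on [sdp_B i j] is an
   instance of nonexpansiveness. *)
have rho_star i : exists w, gram_factor *m sdp_rho_star alpha beta i = w /\
    gram_factor *m sdp_sigma_star i = T w.
  case: i => [[k kK]|] /=.
    exists (z k); rewrite gram_factor_sigma //; split=> //.
    by have [_ ->] := gram_factor_eta_rho kK.
  by exists zs; rewrite !gram_factor_ebas //= ltnn.
split.
- by rewrite trG mulmxBr !gram_factor_ebas // cV.
- rewrite trG mulmxBr !gram_factor_ebas //= ltnn -zsE subrr.
  by rewrite qform0 mulr0.
- move=> i j; rewrite /sdp_B mulmxBr raddfB /= !trG !mulmxBr.
  have [u [-> ->]] := rho_star i; have [v [-> ->]] := rho_star j.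
  rewrite -mulrBr pmulr_rle0 ?invr_gt0 // subr_le0 -!wnorm_sq //.
  by rewrite ler_pXn2r ?nnegrE ?sqrtr_ge0 //; exact: nT.
- split.
    by rewrite /G linearZ /= !trmx_mul trmxK sR.1 mulmxA.
  move=> v; rewrite qformE /G /mdot -scalemxAr -scalemxAl mxE.
  by rewrite mulr_ge0 ?invr_ge0 ?(ltW c0) // -/(qform _ _) qform_congr sR.2.
Qed.

End SDPBound.

(** * Proximal maps and projections *)

Section ProxExistence.
Context {R : realType} {n : nat}.
Implicit Types (u v w : 'cV[R]_n) (h : 'cV[R]_n -> \bar R).

Lemma trmx_continuous m p : continuous (@trmx R m p).
Proof.
move=> M A [P nP sPA]; exists (fun i j => P j i) => [i j|N PN].
  by have := nP j i; rewrite !mxE.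
by apply: sPA => i j; rewrite mxE; exact: PN.
Qed.

(** The box is the image under transposition of a product of segments of row vectors. *)
Lemma box_compact (l u : 'cV[R]_n) : compact (box l u).
Proof.
pose I i := `[l i 0, u i 0]%classic.
have -> : box l u = trmx @` [set v : 'rV[R]_n | forall i, I i (v ord0 i)].
  apply/seteqP; split=> [v lvu|_ [v lvu <-] i] /=.
    by exists v^T; rewrite ?trmxK // => i; rewrite /I /= mxE in_itv; exact: lvu.
  by rewrite mxE; have := lvu i; rewrite /I /= in_itv.
apply: continuous_compact.
  by apply: continuous_subspaceT; exact: trmx_continuous.
by apply: (rV_compact (A := I)) => i; exact: segment_compact.
Qed.

(** Otherwise some sequence in [B] has [h (s k) < - k]. At a cluster point [p], closedness of the
    epigraph gives [h p <= t] for every real [t], hence [h p = -oo]. *)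
Lemma closed_fct_bounded_below h (B : set 'cV[R]_n) : closed_fct h ->
  (forall w, h w != -oo%E) -> compact B ->
  exists m : R, forall u, B u -> (m%:E <= h u)%E.
Proof.
move=> ch hNy cB; apply: contrapT => /forallNP nm.
have /choice[s sP] (k : nat) : exists u, B u /\ (h u < (- k%:R)%:E)%E.
  have /existsNP[u /not_implyP[Bu /negP]] := nm (- k%:R).
  by rewrite -ltNge; exists u.
have [p [Bp clp]] : B `&` cluster (s @ \oo) !=set0.
  by apply: cB; exists 0%N => // k _; exact: (sP k).1.
have hp (t : R) : (h p <= t%:E)%E.
  apply: (ch (p, t)) => N [[U V] /= [pU tV] sUV].
  pose k0 := Num.bound `|t|.
  have [_ [[k k0k <-] Usk]] : (s @` [set k | (k0 <= k)%N]) `&` U !=set0.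
    by apply: clp => //; exists k0 => // k k0k; exists k.
  exists (s k, t); split; last by apply: sUV; split => //; exact: nbhs_singleton.
  rewrite /= (le_trans (ltW (sP k).2)) // lee_fin lerNl.
  rewrite (le_trans (ler_norm _)) // normrN (le_trans (ltW (archi_boundP _))) //.
  by rewrite ler_nat.
have := hNy p; case: (h p) hp => [r /(_ (r - 1))| /(_ 0)|] //.
by rewrite lee_fin lerBDr gerDl ler10.
Qed.

Lemma coord_le_norm2 v i : `|v i 0| <= norm2 v.
Proof.
rewrite -(@ler_pXn2r _ 2) ?nnegrE ?sqrtr_ge0 // norm2_sq real_normK ?num_real //.
rewrite /mdot mulmx1 mxE (bigD1 i) //= mxE -expr2 lerDl.
by apply: sumr_ge0 => j _; rewrite mxE -expr2 sqr_ge0.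
Qed.

Lemma coord_sum_continuous (f : 'I_n -> R -> R) : (forall i, continuous (f i)) ->
  continuous (fun u : 'cV[R]_n => \sum_i f i (u i 0)).
Proof.
move=> cf; have C i : continuous (fun u : 'cV[R]_n => f i (u i 0)).
  move=> u; apply: (@continuous_comp _ _ _ (fun u : 'cV[R]_n => u i 0)).
    exact: coord_continuous.
  exact: cf.
exact: (@continuous_big R _ +%R 0 predT (@add_continuous R) _ _
  (fun i u => f i (u i 0)) (fun i _ => C i)).
Qed.

Lemma norm2_sq_continuous v : continuous (fun u => norm2 (u - v) ^+ 2).
Proof.
have -> : (fun u => norm2 (u - v) ^+ 2) =
    (fun u => \sum_i (u i 0 - v i 0) * (u i 0 - v i 0)).
  apply/funext => u; rewrite norm2_sq /mdot mulmx1 mxE.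
  by apply: eq_bigr => i _; rewrite !mxE.
have C i : continuous (fun s : R => s - v i 0).
  by move=> s; exact: (cvgB cvg_id (cvg_cst _)).
apply: (coord_sum_continuous (f := fun i s => (s - v i 0) * (s - v i 0))).
by move=> i s; exact: (cvgM (C i s) (C i s)).
Qed.

Lemma mdot1_continuous v : continuous (fun u => mdot 1%:M v u).
Proof.
have -> : mdot 1%:M v = (fun u => \sum_i v i 0 * u i 0).
  apply/funext => u; rewrite /mdot mulmx1 mxE.
  by apply: eq_bigr => i _; rewrite !mxE.
apply: (coord_sum_continuous (f := fun i s => v i 0 * s)).
by move=> i s; exact: (cvgM (cvg_cst _) cvg_id).
Qed.

(** The parallelogram identity for [u - v] and [w - v], with the square of their sum dropped. *)
Lemma norm2_sq_triangle u v w :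
  norm2 (u - w) ^+ 2 <= 2 * norm2 (u - v) ^+ 2 + 2 * norm2 (w - v) ^+ 2.
Proof.
have := sqr_ge0 (norm2 ((u - v) + (w - v))); rewrite !norm2_sq !mdotE.
by rewrite (mdotC v u) ?(mdotC w u) ?(mdotC w v) ?trmx1 // => ?; lra.
Qed.

Lemma prox_exists h v : ccp_fct h ->
  exists u, argmin (fun u => h u + (2^-1 * norm2 (u - v) ^+ 2)%:E)%E u.
Proof.
move=> [ch xh [hNy [w0 hw0]]].
have [a ha] : exists a, h w0 = a%:E.
  by have := hNy w0; case: (h w0) hw0 => // a _ _; exists a.
(* A sup-norm ball around [w0]: it is compact and contains the Euclidean ball of the same radius. *)
pose ball r := box (\col_i (w0 i 0 - r)) (\col_i (w0 i 0 + r)).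
have ballP r u : norm2 (u - w0) <= r -> ball r u.
  move=> ur i; rewrite !mxE; have := le_trans (coord_le_norm2 (u - w0) i) ur.
  by rewrite !mxE ler_norml; lra.
have [m mP] := closed_fct_bounded_below ch hNy (@box_compact _ _ : compact (ball 1)).
have n0 : norm2 (w0 - w0) = 0.
  by apply/eqP; rewrite -sqrf_eq0 norm2_sq subrr -qformE qform0.
have ma : m <= a.
  by rewrite -lee_fin -ha; apply: mP; apply: ballP; rewrite n0.
set D := norm2 (w0 - v) ^+ 2.
(* For a sublevel point at distance [s > 1] from [w0], the estimates below give
   [s^2 < 4 s (a - m) + 4 D], which fails once [s > r]. *)
pose r := 1 + 4 * (a - m) + 4 * D.
have D0 : 0 <= D by exact: sqr_ge0.
(* Convexity on the segment from [w0] to [u], together with the lower bound [m]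
   on the unit ball, bounds [h u] below by an affine function of [norm2 (u - w0)];
   the quadratic term then confines sublevel points to the ball of radius [r]. *)
have near_w0 u t : h u = t%:E -> t + 2^-1 * norm2 (u - v) ^+ 2 < a + 2^-1 * D ->
    norm2 (u - w0) <= r.
  move=> hu lt; rewrite leNgt; apply/negP; set s := norm2 (u - w0) => rs.
  have s1 : 1 < s by rewrite (le_lt_trans _ rs) // /r; lra.
  have s0 : 0 < s by lra.
  have sV : 0 < s^-1 < 1 by rewrite invr_gt0 s0 invf_lt1.
  have : (m%:E <= h (s^-1 *: u + (1 - s^-1) *: w0)%R)%E.
    apply: mP; apply: ballP; rewrite -(@ler_pXn2r _ 2) ?nnegrE ?sqrtr_ge0 //.
    have -> : s^-1 *: u + (1 - s^-1) *: w0 - w0 = s^-1 *: (u - w0).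
      by apply/colP => i; rewrite !mxE; ring.
    rewrite norm2_sq !mdotZl !mdotZr -norm2_sq -/s mulrA -expr2 -exprMn.
    by rewrite mulVf ?gt_eqF.
  move=> /le_trans /(_ (xh u w0 _ sV)); rewrite hu ha -!EFinM -EFinD lee_fin => H.
  have {}H : s * m <= t + (s - 1) * a.
    have := ler_wpM2l (ltW s0) H; rewrite mulrDr mulrA mulfV ?gt_eqF // mul1r mulrA.
    by rewrite mulrBr mulr1 mulfV ?gt_eqF.
  have := norm2_sq_triangle u v w0; rewrite -/s -/D => H2.
  have : s * r < s * s by rewrite ltr_pM2l.
  rewrite /r; nra.
have [m' m'P] := closed_fct_bounded_below ch hNy (@box_compact _ _ : compact (ball r)).
pose M := a + 2^-1 * D.
pose E := (ball r `*` `[m', M]%classic) `&`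
  [set wt : 'cV[R]_n * R | (h wt.1 <= wt.2%:E)%E].
have cE : compact E.
  apply: compact_closedI => //; apply: compact_setX; last exact: segment_compact.
  exact: (@box_compact _ _).
have w0r : ball r w0 by apply: ballP; rewrite n0 /r; lra.
have E0 : E (w0, a).
  split; last by rewrite /= ha.
  split=> //=; rewrite in_itv /= -lee_fin -ha m'P //= /M; lra.
(* The infimum of [h] plus a quadratic is attained on the compact truncation [E]
   of the epigraph, on which the objective becomes the continuous [phi]. *)
pose phi (p : 'cV[R]_n * R) := p.2 + 2^-1 * norm2 (p.1 - v) ^+ 2.
have cphi : continuous phi.
  move=> p; have H1 : continuous_at p (snd : 'cV[R]_n * R -> R) by exact: cvg_snd.
  have H2 : continuous_at p (fun q : 'cV[R]_n * R => norm2 (q.1 - v) ^+ 2 : R).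
    apply: (@continuous_comp _ _ _ fst (fun u => norm2 (u - v) ^+ 2 : R)).
      exact: cvg_fst.
    exact: norm2_sq_continuous.
  have H3 : continuous_at p
      (fun q : 'cV[R]_n * R => 2^-1 * norm2 (q.1 - v) ^+ 2 : R).
    by exact: (cvgM (cvg_cst _) H2).
  by exact: (cvgD H1 H3).
have [[u t] uE umin] :=
  compact_EVT_min (ex_intro _ _ E0) cE (continuous_subspaceT cphi).
have [[_ _] /= hut] : E (u, t) by rewrite inE in uE.
exists u => w.
have fu p : E p -> (h u + (2^-1 * norm2 (u - v) ^+ 2)%:E <= (phi p)%:E)%E.
  move=> Ep; apply: (@le_trans _ _ (phi (u, t))%:E).
    by rewrite EFinD leeD2r.
  by rewrite lee_fin; apply: umin; rewrite inE.
case hw : (h w) => [tau| |]; last 2 first.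
- by rewrite addye // leey.
- by have := hNy w; rewrite hw.
(* A competitor whose objective is below that of [w0] yields a point of [E]; any other is compared
   through [w0] itself. *)
rewrite -EFinD; have [lt|ge] := ltP (tau + 2^-1 * norm2 (w - v) ^+ 2) (a + 2^-1 * D).
  apply: (fu (w, tau)); split; last by rewrite /= hw.
  have wr := ballP _ _ (near_w0 _ _ hw lt).
  split=> //=; rewrite in_itv /= -lee_fin -hw m'P //= /M.
  by have := sqr_ge0 (norm2 (w - v)); lra.
by rewrite (le_trans (fu _ E0)) // lee_fin.
Qed.

End ProxExistence.

(** Replaces the limit [t -> 0] in first-order optimality arguments. If [a > 0], then [b > 0] and
    [t = a / (2 (a + b))] gives [t b < a / 2], a contradiction. *)
Lemma le0_of_le_scaled {R : realType} (a b : R) :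
  (forall t, 0 < t < 1 -> a <= t * b) -> a <= 0.
Proof.
move=> h; rewrite leNgt; apply/negP => a0.
have b0 : 0 < b by have := h 2^-1; lra.
pose t := a / (2 * (a + b)).
have ab : 0 < 2 * (a + b) by lra.
have t01 : 0 < t < 1 by rewrite /t divr_gt0 //= ltr_pdivrMr //; lra.
have := h t t01; rewrite /t mulrAC ler_pdivlMr //; nra.
Qed.

(** * Variational inequalities for proximal maps and projections *)

Section ProxInequalities.
Context {R : realType} {n : nat}.
Implicit Types (u v w : 'cV[R]_n) (h : 'cV[R]_n -> \bar R).

(** First-order optimality: [v - prox h v] is a subgradient of [h] at [prox h v]. Minimality is
    tested at points of the segment towards [w], using convexity; after division by the step [s],
    the quadratic remainder is [s] times a constant. *)
Lemma prox_variational h v : ccp_fct h ->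
  exists2 a, h (prox h v) = a%:E &
    forall w t, h w = t%:E -> a + mdot 1%:M (v - prox h v) (w - prox h v) <= t.
Proof.
move=> ch; have [_ xh [hNy [w0 hw0]]] := ch.
have := xgetPex 0 (prox_exists v ch); rewrite -/(prox h v).
move: (prox h v) => u umin.
have [a ha] : exists a, h u = a%:E.
  have /= := umin w0; have := hNy u; case: (h u) => [r _ _| |] //.
    by exists r.
  by have := hNy w0; case: (h w0) hw0.
exists a => // w t hw; rewrite -subr_le0.
set q := mdot 1%:M (w - u) (w - u).
apply: (@le0_of_le_scaled _ _ (2^-1 * q)) => s s01.
have su : s *: w + (1 - s) *: u - v = (u - v) + s *: (w - u).
  by apply/colP => i; rewrite !mxE; ring.
have := le_trans (umin _) (leeD2r _ (xh w u s s01)).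
rewrite ha hw su -!EFinM -!EFinD lee_fin !norm2_sq -(opprB u v) mdotNl.
move: (u - v) (w - u) @q => x d q; rewrite !mdotE (mdotC x d) ?trmx1 // -/q => H.
have [s0 _] := andP s01; rewrite -(ler_pM2l s0); nra.
Qed.

(** Sum of the two subgradient inequalities, each tested at the other proximal point. *)
Lemma prox_firm h x y : ccp_fct h ->
  0 <= mdot 1%:M (prox h x - prox h y) (x - y - (prox h x - prox h y)).
Proof.
move=> ch; have [a ha aP] := prox_variational x ch.
have [b hb bP] := prox_variational y ch.
have := aP _ _ hb; have := bP _ _ ha.
move: (prox h x) (prox h y) => u v; rewrite !mdotE.
rewrite !(mdotC v) ?(mdotC u x) ?(mdotC u y) ?trmx1 //; lra.
Qed.

Definition indicator (C : set 'cV[R]_n) u : \bar R :=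
  if u \in C then 0%E else +oo%E.

Lemma indicator_in C u : C u -> indicator C u = 0%E.
Proof. by rewrite /indicator => Cu; rewrite mem_set. Qed.

Lemma indicator_out C u : ~ C u -> indicator C u = +oo%E.
Proof. by rewrite /indicator => Cu; rewrite memNset. Qed.

Definition closed_convex (C : set 'cV[R]_n) : Prop :=
  [/\ C !=set0, closed C &
    forall u v (t : R), C u -> C v -> 0 < t < 1 -> C (t *: u + (1 - t) *: v)].

Lemma indicator_ccp C : closed_convex C -> ccp_fct (indicator C).
Proof.
move=> [[c Cc] clC xC]; split.
- rewrite /closed_fct.
  have -> : [set wt : 'cV[R]_n * R | (indicator C wt.1 <= wt.2%:E)%E] =
      (fst @^-1` C) `&` (snd @^-1` [set t : R | 0 <= t]).
    apply/seteqP; split=> -[w t] /=.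
      have [Cw|Cw] := pselect (C w); first by rewrite indicator_in // lee_fin.
      by rewrite indicator_out // leye_eq.
    by move=> [Cw t0]; rewrite indicator_in // lee_fin.
  apply: closedI.
    by apply: preimage_closed => // p _; exact: cvg_fst.
  by apply: preimage_closed => [p _|]; [exact: cvg_snd|exact: closed_ge].
- move=> u v t t01.
  have [t0 t1] := andP t01.
  have [Cu|Cu] := pselect (C u); last first.
    rewrite (indicator_out Cu) gt0_muley ?lte_fin // addye ?leey //.
    have [Cv|Cv] := pselect (C v); first by rewrite indicator_in // mule0.
    by rewrite indicator_out // gt0_muley // lte_fin subr_gt0.
  have [Cv|Cv] := pselect (C v); last first.
    rewrite (indicator_out Cv) gt0_muley ?lte_fin ?subr_gt0 //.
    by rewrite (indicator_in Cu) mule0 add0e leey.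
  by rewrite !indicator_in ?mule0 ?adde0 //; exact: xC.
- split=> [w|]; last by exists c; rewrite indicator_in // ltry.
  by rewrite /indicator; case: ifP.
Qed.

(** The two sets of minimizers coincide, so existence and the variational inequality for projections
    are inherited from [prox]. *)
Lemma euclid_proj_prox C v : C !=set0 -> euclid_proj C v = prox (indicator C) v.
Proof.
move=> [c Cc]; rewrite /euclid_proj /prox; congr xget.
have le2 u w : (norm2 (u - v) <= norm2 (w - v)) =
    (2^-1 * norm2 (u - v) ^+ 2 <= 2^-1 * norm2 (w - v) ^+ 2).
  by rewrite ler_pM2l ?invr_gt0 // ler_pXn2r // nnegrE sqrtr_ge0.
apply/seteqP; split=> u /=.
  move=> [Cu umin] w; rewrite (indicator_in Cu) add0e.
  have [Cw|Cw] := pselect (C w); last by rewrite indicator_out // addye // leey.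
  by rewrite indicator_in // add0e lee_fin -le2; exact: umin.
move=> umin; have Cu : C u.
  apply: contrapT => Cu; have := umin c.
  by rewrite indicator_out // indicator_in // addye // add0e leye_eq.
split=> // w Cw; have := umin w.
by rewrite !indicator_in // !add0e lee_fin -le2.
Qed.

Lemma euclid_projP C v : closed_convex C ->
  C (euclid_proj C v) /\ forall w, C w ->
    mdot 1%:M (v - euclid_proj C v) (w - euclid_proj C v) <= 0.
Proof.
move=> cC; rewrite euclid_proj_prox; last by case: cC.
have [a ha aP] := prox_variational v (indicator_ccp cC).
have Cu : C (prox (indicator C) v).
  by apply: contrapT => /indicator_out; rewrite ha.
split=> // w /indicator_in/aP.
by move: ha; rewrite indicator_in // => -[<-]; rewrite add0r.
Qed.

Lemma scale_ccp (eta : R) h : 0 < eta -> ccp_fct h ->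
  ccp_fct (fun u => eta%:E * h u)%E.
Proof.
move=> eta0 [clh xh [hNy [w hw]]]; split.
- rewrite /closed_fct.
  have -> : [set wt : 'cV[R]_n * R | (eta%:E * h wt.1 <= wt.2%:E)%E] =
      (fun p => (p.1, eta^-1 * p.2)) @^-1` [set wt | (h wt.1 <= wt.2%:E)%E].
    apply/seteqP; split=> -[u t] /=.
      by rewrite EFinM lee_pdivlMl.
    by rewrite EFinM lee_pdivlMl.
  apply: preimage_closed => // p _.
  have H : continuous_at p (fun q : 'cV[R]_n * R => eta^-1 * q.2).
    exact: (cvgM (cvg_cst _) cvg_snd).
  by have := cvg_pair (@cvg_fst _ _ (nbhs p.1) (nbhs p.2) _) H; exact.
- move=> u v t t01; have [t0 t1] := andP t01.
  apply: (le_trans (lee_wpmul2l _ (xh u v t t01))); first by rewrite lee_fin ltW.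
  have ye (r : R) : 0 < r -> (r%:E * +oo = +oo)%E.
    by move=> r0; rewrite gt0_muley ?lte_fin.
  have t1' : 0 < 1 - t by rewrite subr_gt0.
  have := hNy u; have := hNy v.
  case: (h u) => [a| |] //; case: (h v) => [b| |] // _ _.
  + by rewrite -!EFinM -!EFinD -?EFinM lee_fin; lra.
  + by rewrite !ye // addey // !ye // leey.
  + by rewrite !ye // addye // !ye // leey.
  + by rewrite !ye // addye // !ye // leey.
- split=> [u|]; last first.
    exists w; have := hNy w; case: (h w) hw => // a _ _.
    by rewrite -EFinM ltry.
  by have := hNy u; case: (h u) => // _; rewrite gt0_muley.
Qed.

Lemma box_closed_convex (l u : 'cV[R]_n) : (forall i, l i 0 <= u i 0) ->
  closed_convex (box l u).
Proof.
move=> lu; split.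
- by exists l => i; rewrite lexx lu.
- by apply: compact_closed; [exact: norm_hausdorff|exact: (@box_compact _ _)].
- move=> v w t hv hw t01 i; rewrite !mxE.
  by have := hv i; have := hw i; nra.
Qed.

(* The box constraint is separable, so the projection is monotone coordinatewise
   and hence also in every diagonally weighted inner product. *)
Lemma box_proj_firm (l u : 'cV[R]_n) (x y : 'cV[R]_n) i :
  (forall i, l i 0 <= u i 0) ->
  let d := (euclid_proj (box l u) x - euclid_proj (box l u) y) i 0 in
  0 <= d * ((x - y) i 0 - d).
Proof.
move=> lu; have cB := box_closed_convex lu.
have coord v w : box l u w ->
    (v - euclid_proj (box l u) v) i 0 * (w - euclid_proj (box l u) v) i 0 <= 0.
  move=> Bw; have [Bv vP] := euclid_projP v cB.
  (* The test point differs from the projection only in coordinate [i], so a single term of the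
     inner product survives. *)
  pose w' := \col_j (if j == i then w j 0 else (euclid_proj (box l u) v) j 0).
  have := vP w'; rewrite /mdot mulmx1 mxE (bigD1 i) //= big1 => [|j ji].
    rewrite addr0 /w' !mxE eqxx; apply => j; rewrite mxE; case: ifP => _.
      exact: Bw.
    exact: Bv.
  by rewrite /w' !mxE (negbTE ji) subrr mulr0.
have := coord x _ (euclid_projP y cB).1; have := coord y _ (euclid_projP x cB).1.
rewrite /= !mxE; nra.
Qed.

End ProxInequalities.

(** * The three algorithms *)

Section WeightedForms.
Context {R : realType}.

Lemma mdot1_trmul m n (A : 'M[R]_(m, n)) (N : 'M[R]_m) u v :
  mdot 1%:M u (A^T *m N *m v) = mdot N (A *m u) v.
Proof. by rewrite /mdot mulmx1 trmx_mul !mulmxA. Qed.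

Lemma mdot1_mul n (N : 'M[R]_n) u v : mdot 1%:M u (N *m v) = mdot N u v.
Proof. by rewrite /mdot mulmx1 mulmxA. Qed.

Lemma mdot_diag n (d : 'rV[R]_n) u v :
  mdot (diag_mx d) u v = \sum_i d 0 i * (u i 0 * v i 0).
Proof.
rewrite /mdot mul_mx_diag mxE; apply: eq_bigr => i _.
by rewrite !mxE; ring.
Qed.

Lemma mdot1E n (u v : 'cV[R]_n) : mdot 1%:M u v = \sum_i u i 0 * v i 0.
Proof. by rewrite /mdot mulmx1 mxE; apply: eq_bigr => i _; rewrite mxE. Qed.

Lemma mdot1_ge0 n (u : 'cV[R]_n) : 0 <= mdot 1%:M u u.
Proof. by rewrite -norm2_sq sqr_ge0. Qed.

Lemma mdot1_col m n (a c : 'cV[R]_m) (b d : 'cV[R]_n) :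
  mdot 1%:M (col_mx a b) (col_mx c d) = mdot 1%:M a c + mdot 1%:M b d.
Proof.
by rewrite !mdot1E big_split_ord; congr (_ + _); apply: eq_bigr => i _;
  rewrite ?(col_mxEu, col_mxEd).
Qed.

Lemma mdot_diag_col m n (s : R) (r : 'cV[R]_n) (a c : 'cV[R]_m) (b d : 'cV[R]_n) :
  mdot (diag_mx (col_mx (const_mx s) r)^T) (col_mx a b) (col_mx c d) =
    s * mdot 1%:M a c + mdot (diag_mx r^T) b d.
Proof.
rewrite !mdot_diag mdot1E big_split_ord mulr_sumr; congr (_ + _);
  apply: eq_bigr => i _; by rewrite mxE ?(col_mxEu, col_mxEd) mxE.
Qed.

Lemma posdef_diag n (d : 'rV[R]_n) : (forall i, 0 < d 0 i) -> posdef (diag_mx d).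
Proof.
move=> d0; split=> [|v v0]; first exact: tr_diag_mx.
rewrite qformE mdot_diag lt_def; apply/andP; split; last first.
  by apply: sumr_ge0 => i _; rewrite mulr_ge0 ?(ltW (d0 i)) // -expr2 sqr_ge0.
apply: contra_neq v0 => s0; apply/colP => i; rewrite mxE.
have dv j : predT j -> 0 <= d 0 j * (v j 0 * v j 0).
  by rewrite mulr_ge0 ?(ltW (d0 j)) // -expr2 sqr_ge0.
have /eqP := psumr_eq0P dv s0 (isT : predT i).
by rewrite mulf_eq0 gt_eqF //= mulf_eq0 orbb => /eqP.
Qed.

Lemma posdef1 n : posdef (1%:M : 'M[R]_n).
Proof. by rewrite -diag_const_mx; apply: posdef_diag => i; rewrite mxE. Qed.

(** The hypothesis is firm nonexpansiveness, that is, the condition of [qform_reflect_le] on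
    differences. *)
Lemma nonexpansive_reflect n (M : 'M[R]_n) (T : 'cV[R]_n -> 'cV[R]_n) :
  M^T = M ->
  (forall y z, 0 <= mdot M (T y - T z) (y - z - (T y - T z))) ->
  nonexpansive M (fun z => 2 *: T z - z).
Proof.
move=> sM fT y z; apply: ler_wsqrtr.
have -> : 2 *: T y - y - (2 *: T z - z) = 2 *: (T y - T z) - (y - z).
  by apply/colP => i; rewrite !mxE; ring.
exact: qform_reflect_le.
Qed.

Lemma nonexpansive_comp n (M : 'M[R]_n) (S1 S2 S : 'cV[R]_n -> 'cV[R]_n) :
  nonexpansive M S1 -> nonexpansive M S2 -> (forall z, S z = S1 (S2 z)) ->
  nonexpansive M S.
Proof. by move=> n1 n2 SE y z; rewrite !SE; apply: le_trans (n2 y z); exact: n1. Qed.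

End WeightedForms.

Lemma half_step_affine (R : realType) d (a : algorithm R d) x al z :
  half_step x al z = al *: half_step (a := a) x 1 z + (1 - al) *: z.
Proof.
case: a z => [q eta f g|p meq mineq s r1 r2 P A c l u|
  p mz mnz r1 r2 r3 P A c b Knz] z.
- by rewrite /= /admm_half; apply/colP => i; rewrite !mxE; ring.
- rewrite /= /osqp_half -[z in RHS]vsubmxK !col_mxKu !col_mxKd.
  rewrite !scale_col_mx add_col_mx.
  by congr col_mx; apply/colP => i; rewrite !mxE; ring.
- by rewrite /= /scs_half; apply/colP => i; rewrite !mxE; ring.
Qed.

Lemma fixed_point_form_reflect (R : realType) d (X : set 'cV[R]_d)
    (a : algorithm R d) K alpha beta z0 :
  fixed_point_form X K alpha beta z0
    (fun z x => 2 *: half_step (a := a) x 1 z - z).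
Proof.
move=> x k _ _; split=> //; rewrite /yiter /ziter /= half_step_affine.
by apply/colP => i; rewrite !mxE; field.
Qed.

Lemma admm_nonexpansive (R : realType) q (eta : R) (f g : 'cV[R]_q -> \bar R) :
  0 < eta -> ccp_fct f -> ccp_fct g ->
  nonexpansive 1%:M (fun z => 2 *: admm_half eta f g 1 z - z).
Proof.
move=> eta0 cf cg.
set F := prox (fun u => eta%:E * f u)%E; set G := prox (fun u => eta%:E * g u)%E.
apply: (@nonexpansive_comp _ _ _ (fun z => 2 *: G z - z) (fun z => 2 *: F z - z)).
- by apply: nonexpansive_reflect (trmx1 _ _) _ => y z; exact/prox_firm/scale_ccp.
- by apply: nonexpansive_reflect (trmx1 _ _) _ => y z; exact/prox_firm/scale_ccp.
(* With [r = 2 F z - z], the identity is [2 (z + G r - F z) - z = 2 G r - r]. *)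
move=> z; rewrite /admm_half -/F -/G.
by apply/colP => i; rewrite !mxE; ring.
Qed.

(** * Firm nonexpansiveness of the OSQP step *)

Section OSQP.
Context {R : realType} (p meq mineq : nat) (sigma rho_eq rho_ineq : R).
Variables (P : 'M[R]_p) (A : 'M[R]_(meq + mineq, p)) (c : 'cV[R]_p).
Variables (l u : 'cV[R]_(meq + mineq)).
Hypothesis (sigma0 : 0 < sigma) (rho_eq0 : 0 < rho_eq) (rho_ineq0 : 0 < rho_ineq).
Hypothesis pP : possemidef P.
Hypothesis lu : forall i, l i 0 <= u i 0.
Let rho := osqp_rho meq mineq rho_eq rho_ineq.
Let Drho := diag_mx rho^T.

Lemma osqp_rho_gt0 i : 0 < rho i 0.
Proof.
by rewrite /rho /osqp_rho; case: (split_ordP i) => j ->;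
  rewrite ?(col_mxEu, col_mxEd) mxE.
Qed.

Definition osqp_metric : 'M[R]_(p + (meq + mineq)) :=
  diag_mx (col_mx (const_mx sigma) rho)^T.

Lemma osqp_metric_posdef : posdef osqp_metric.
Proof.
apply: posdef_diag => i; rewrite mxE; case: (split_ordP i) => j ->.
  by rewrite col_mxEu mxE.
by rewrite col_mxEd osqp_rho_gt0.
Qed.

Lemma osqp_system_unit : P + sigma%:M + A^T *m Drho *m A \in unitmx.
Proof.
apply: posdef_unit => v v0; rewrite qformE !mdot_add_mx.
have -> : mdot sigma%:M v v = sigma * mdot 1%:M v v.
  by rewrite -mdot1_mul mul_scalar_mx mdotZr.
have -> : mdot (A^T *m Drho *m A) v v = mdot Drho (A *m v) (A *m v).
  by rewrite -mdot1_mul -mulmxA mdot1_trmul.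
have := (posdef_possemidef (posdef_diag (d := rho^T) _)).2 (A *m v).
rewrite -qformE => /(_ _) H.
have H1 : 0 <= qform Drho (A *m v).
  by apply: H => i; rewrite mxE osqp_rho_gt0.
have := pP.2 v; have := (@posdef1 R p).2 v v0; rewrite !qformE => h1 h2.
have : 0 < sigma * mdot 1%:M v v by rewrite mulr_gt0.
by rewrite qformE in H1; lra.
Qed.

(** Pairing the difference of the two linear systems with [ds] turns the inner product into
    [qform P ds + mdot Drho dv (dx - dv)]. The first term is nonnegative because [P] is
    semidefinite, the second by [box_proj_firm]. *)
Lemma osqp_firm y z :
  let T := osqp_half sigma rho_eq rho_ineq P A c l u 1 in
  0 <= mdot osqp_metric (T y - T z) (y - z - (T y - T z)).
Proof.
rewrite /= /osqp_half -/rho -/Drho.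
rewrite -(vsubmxK y) -(vsubmxK z).
move: (usubmx y) (dsubmx y) (usubmx z) (dsubmx z) => w1 x1 w2 x2.
rewrite !col_mxKu !col_mxKd.
set Q := P + _ + _.
set v1 := euclid_proj _ x1; set v2 := euclid_proj _ x2.
set b1 := sigma *: w1 - _ + _; set b2 := sigma *: w2 - _ + _.
have := solutionP b1 osqp_system_unit; have := solutionP b2 osqp_system_unit.
rewrite -/Q; move: (solution Q b1) (solution Q b2) => s1 s2 e2 e1.
set dw := w1 - w2; set dx := x1 - x2; set dv := v1 - v2; set ds := s1 - s2.
have firm : 0 <= mdot Drho dv (dx - dv).
  rewrite mdot_diag; apply: sumr_ge0 => i _.
  rewrite mulr_ge0 //; first by rewrite mxE ltW ?osqp_rho_gt0.
  by have := @box_proj_firm _ _ l u x1 x2 i lu; rewrite /= !mxE.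
have eQ : Q *m ds = sigma *: dw + A^T *m Drho *m (2 *: dv - dx).
  rewrite /ds mulmxBr e1 e2 /b1 /b2.
  have -> : 2 *: dv - dx = (2 *: v1 - x1) - (2 *: v2 - x2).
    by apply/colP => i; rewrite !mxE; ring.
  rewrite (mulmxBr _ (2 *: v1 - x1)) /dw.
  move: (_ *m (2 *: v1 - x1)) (_ *m (2 *: v2 - x2)) => a1 a2.
  by apply/colP => i; rewrite !mxE; ring.
rewrite !(opp_col_mx, add_col_mx) /osqp_metric mdot_diag_col -/Drho.
have -> : w1 + 1 *: (s1 - w1) - (w2 + 1 *: (s2 - w2)) = ds.
  by apply/colP => i; rewrite !mxE; ring.
have -> : w1 - w2 - ds = dw - ds by [].
have -> : x1 + 1 *: (A *m s1 + x1 - v1 - x1) -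
    (x2 + 1 *: (A *m s2 + x2 - v2 - x2)) =
   A *m ds + dx - dv.
  rewrite /ds mulmxBr; move: (A *m s1) (A *m s2) => a1 a2.
  by apply/colP => i; rewrite !mxE; ring.
have -> : x1 - x2 - (A *m ds + dx - dv) = dv - A *m ds.
  by apply/colP => i; rewrite !mxE; ring.
have hQ := congr1 (mdot 1%:M ds) eQ; move: hQ firm (pP.2 ds).
rewrite [X in _ = X]mdotDr mdotZr mdot1_trmul /Q !mulmxDl mul_scalar_mx.
rewrite (mdotDr _ (_ + _)) (mdotDr _ (P *m ds)) (mdotZr _ sigma _ ds).
rewrite mdot1_mul -!mulmxA mulmxA mdot1_trmul qformE.
clearbody dw dx dv ds; move: (A *m ds) => a; rewrite !mdotE.
rewrite (mdotC dx a) ?tr_diag_mx // (mdotC dv a) ?tr_diag_mx //.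
rewrite (mdotC dx dv) ?tr_diag_mx //.
lra.
Qed.

End OSQP.

(** * Nonexpansiveness of the SCS operator *)

Section SCS.
Context {R : realType} (p mz mnz : nat) (r_w r_yz r_ynz : R).
Variables (P : 'M[R]_p) (A : 'M[R]_(mz + mnz, p)) (c : 'cV[R]_p).
Variables (b : 'cV[R]_(mz + mnz)) (Knz : set 'cV[R]_mnz).
Hypothesis (r_w0 : 0 < r_w) (r_yz0 : 0 < r_yz) (r_ynz0 : 0 < r_ynz).
Hypothesis pP : possemidef P.

Definition scs_metric : 'M[R]_(p + (mz + mnz)) :=
  diag_mx (col_mx (const_mx r_w : 'cV[R]_p)
             (col_mx (const_mx r_yz : 'cV[R]_mz) (const_mx r_ynz : 'cV[R]_mnz)))^T.

Let M : 'M[R]_(p + (mz + mnz)) := block_mx (1%:M + P) A^T (- A) 1%:M.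

Definition scs_dual : set 'cV[R]_(p + (mz + mnz)) :=
  [set v | dual_cone (@scs_cone R mz mnz Knz) (dsubmx v)].

Lemma scs_metric_posdef : posdef scs_metric.
Proof.
apply: posdef_diag => i; rewrite mxE; case: (split_ordP i) => j ->.
  by rewrite col_mxEu mxE.
by rewrite col_mxEd; case: (split_ordP j) => k ->;
  rewrite ?(col_mxEu, col_mxEd) mxE.
Qed.

(** The blocks [A^T] and [- A] cancel in the form, leaving the nonnegative contributions of [1 + P]
    and [1]. *)
Lemma scs_monotone v : 0 <= mdot M v v.
Proof.
rewrite -mdot1_mul -(vsubmxK v); move: (usubmx v) (dsubmx v) => x y.
rewrite /M mul_block_col mdot1_col !mulmxDl !mdotDr !mul1mx mulNmx mdotNr mdot1_mul.
have -> : mdot 1%:M x (A^T *m y) = mdot 1%:M y (A *m x).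
  by rewrite -[A^T]mulmx1 mdot1_trmul mdotC ?trmx1.
have := pP.2 x; rewrite qformE.
by have := mdot1_ge0 x; have := mdot1_ge0 y; lra.
Qed.

Lemma scs_system_unit : scs_metric + M \in unitmx.
Proof.
apply: posdef_unit => v v0; rewrite qformE mdot_add_mx.
by have := scs_metric_posdef.2 v v0; have := scs_monotone v; rewrite qformE; lra.
Qed.

(** Pairing the difference of the two systems with [T y - T z] shows that the inner product equals
    the form of [M] at that vector. *)
Lemma scs_resolvent_firm q y z :
  let T x := solution (scs_metric + M) (scs_metric *m x - q) in
  0 <= mdot scs_metric (T y - T z) (y - z - (T y - T z)).
Proof.
rewrite /=.
have := solutionP (scs_metric *m y - q) scs_system_unit.
have := solutionP (scs_metric *m z - q) scs_system_unit.
move: (solution _ (_ *m y - q)) (solution _ (_ *m z - q)) => s t et es.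
have e : (scs_metric + M) *m (s - t) = scs_metric *m (y - z).
  by rewrite mulmxBr es et mulmxBr opprB addrA subrK.
have := congr1 (mdot 1%:M (s - t)) e.
rewrite !mdot1_mul mdot_add_mx (mdotDr _ (y - z)) mdotNr.
by have := scs_monotone (s - t); lra.
Qed.

(** The set is an intersection of closed half-spaces, one for each [z] in the cone. *)
Lemma scs_dual_closed_convex : closed_convex scs_dual.
Proof.
split.
- by exists 0 => z _; rewrite linear0 trmx0 mul0mx mxE.
- have -> : scs_dual = \bigcap_(z in scs_cone Knz)
      (mdot 1%:M (col_mx 0 z) @^-1` [set t : R | 0 <= t]).
    suff E (v : 'cV[R]_(p + (mz + mnz))) z :
        mdot 1%:M (col_mx 0 z) v = ((dsubmx v)^T *m z) 0 0.
      by apply/seteqP; split=> v vC z /vC; rewrite /= E.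
    rewrite -[in LHS](vsubmxK v) mdot1_col (mdotC z) ?trmx1 // {1}/mdot trmx0.
    by rewrite !mul0mx mxE add0r /mdot mulmx1.
  apply: closed_bigI => z _; apply: preimage_closed; last exact: closed_ge.
  by move=> v _; exact: mdot1_continuous.
- move=> v w t vC wC t01 z zK; have := vC z zK; have := wC z zK.
  rewrite !linearD /= !linearZ /= mulmxDl -!scalemxAl !mxE; nra.
Qed.

(* [scs_metric] is the multiple [r_ynz] of the identity on the only block that
   the dual cone constrains, so that [u + r_ynz^-1 scs_metric (w - u)] stays in
   [scs_dual]; testing the Euclidean variational inequality against it gives the
   variational inequality of the weighted inner product. *)
Lemma scs_proj_variational v w : scs_dual w ->
  mdot scs_metric (v - euclid_proj scs_dual v) (w - euclid_proj scs_dual v) <= 0.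
Proof.
move=> Cw; have [Cu uP] := euclid_projP v scs_dual_closed_convex.
move: (euclid_proj _ v) Cu uP => u Cu uP.
have [w' w'def] : exists w', w' = u + r_ynz^-1 *: (scs_metric *m (w - u)).
  by eexists.
have w'E k : w' k 0 = u k 0 + r_ynz^-1 *
    ((col_mx (const_mx r_w : 'cV[R]_p) (col_mx (const_mx r_yz : 'cV[R]_mz)
        (const_mx r_ynz : 'cV[R]_mnz)))^T 0 k * (w k 0 - u k 0)).
  rewrite w'def /scs_metric; move: (_^T) => D; by rewrite mul_diag_mx !mxE.
(* Vectors of the cone vanish on the first [mz] coordinates, so they only test the last block of
   [w'], where it agrees with [w]. *)
have Cw' : scs_dual w'.
  move=> z zK; have [zu _] := zK.
  suff -> : ((dsubmx w')^T *m z) 0 0 = ((dsubmx w)^T *m z) 0 0 by exact: Cw.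
  rewrite -[z]vsubmxK zu -[dsubmx w']vsubmxK -[dsubmx w]vsubmxK !tr_col_mx.
  rewrite !mul_row_col !mulmx0 !add0r; congr ((_^T *m _) 0 0).
  apply/colP => i; rewrite !mxE w'E mxE !col_mxEd mxE; field.
  by rewrite gt_eqF.
have := uP _ Cw'; rewrite w'def addrAC subrr add0r mdotZr mdot1_mul.
by rewrite pmulr_rle0 ?invr_gt0.
Qed.

Lemma scs_proj_firm y z :
  let T := euclid_proj scs_dual in
  0 <= mdot scs_metric (T y - T z) (y - z - (T y - T z)).
Proof.
have := scs_proj_variational y (euclid_projP z scs_dual_closed_convex).1.
have := scs_proj_variational z (euclid_projP y scs_dual_closed_convex).1.
rewrite /=; move: (euclid_proj _ y) (euclid_proj _ z) => u v; rewrite !mdotE.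
have sD := scs_metric_posdef.1.
rewrite !(mdotC v) // (mdotC u y) // (mdotC u z) //; lra.
Qed.

Lemma scs_nonexpansive :
  nonexpansive scs_metric
    (fun z => 2 *: scs_half r_w r_yz r_ynz P A c b Knz 1 z - z).
Proof.
have sD := scs_metric_posdef.1.
pose T x := solution (scs_metric + M) (scs_metric *m x - col_mx c b).
apply: (@nonexpansive_comp _ _ _ (fun z => 2 *: euclid_proj scs_dual z - z)
  (fun z => 2 *: T z - z)).
- by apply: nonexpansive_reflect sD _; exact: scs_proj_firm.
- by apply: nonexpansive_reflect sD _; exact: scs_resolvent_firm.
move=> z; rewrite /scs_half -/scs_metric -/M -/(T z) -/scs_dual.
by apply/colP => i; rewrite !mxE; ring.
Qed.

End SCS.

(** * Existence of the metric and the operator, and the performance bound *)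

Theorem theorem5 (R : realType) (d K : nat) (X : set 'cV[R]_d)
    (a : algorithm R d) (alpha beta : nat -> R)
    (z0 : 'cV[R]_d -> 'cV[R]_(alg_dim a))
    (Hdata : valid_data X a) (Hpos : theta_inv_pos a) :
  (exists (Rm : 'M[R]_(alg_dim a))
          (S : 'cV[R]_(alg_dim a) -> 'cV[R]_d -> 'cV[R]_(alg_dim a)),
     [/\ posdef Rm,
         (forall x, X x -> nonexpansive Rm (S ^~ x)) &
         (forall (K' : nat) (alpha' beta' : nat -> R)
                 (z0' : 'cV[R]_d -> 'cV[R]_(alg_dim a)),
            fixed_point_form X K' alpha' beta' z0' S)]) /\
  (forall (Rm : 'M[R]_(alg_dim a))
          (S : 'cV[R]_(alg_dim a) -> 'cV[R]_d -> 'cV[R]_(alg_dim a))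
          (zstar : 'cV[R]_d -> 'cV[R]_(alg_dim a)),
     posdef Rm ->
     (forall x, X x -> nonexpansive Rm (S ^~ x)) ->
     fixed_point_form X K alpha beta z0 S ->
     (forall x, X x -> zstar x = S (zstar x) x) ->
     forall x, X x ->
       let zK := ziter alpha beta z0 x K in
       ((wnorm Rm (zK - S zK x) ^+ 2)%:E
          <= sdp_value K alpha beta * (wnorm Rm (z0 x - zstar x) ^+ 2)%:E)%E).
Proof.
split; last first.
  move=> Rm S zs pR nS fpS zsE x Xx; cbv zeta.
  apply: (residual_le_sdp pR (nS x Xx) (zsE x Xx)
            (y := yiter alpha beta z0 x) (z := ziter alpha beta z0 x)) => // k kK;
    by have [] := fpS x k Xx kK.
(* For the reflected half-step the fixed-point form is automatic, so existence amounts to finding a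
   metric in which it is nonexpansive. *)
suff [Rm pR nR] : exists2 Rm : 'M[R]_(alg_dim a), posdef Rm &
    forall x, X x -> nonexpansive Rm (fun z => 2 *: half_step (a := a) x 1 z - z).
  exists Rm, (fun z x => 2 *: half_step (a := a) x 1 z - z); split=> // *.
  exact: fixed_point_form_reflect.
case: a Hdata Hpos {z0} => [q eta f g|p meq mineq s r1 r2 P A c l u|
    p mz mnz r1 r2 r3 P A c b Knz] /=.
- move=> cfg eta0; exists 1%:M => [|x Xx]; first exact: posdef1.
  by have [cf cg] := cfg x Xx; exact: admm_nonexpansive.
- move=> lu [s0 r10 r20]; exists (osqp_metric p meq mineq s r1 r2) => [|x Xx].
    exact: osqp_metric_posdef.
  have [pP lux] := lu x Xx; apply: nonexpansive_reflect => [|y z].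
    exact: (osqp_metric_posdef p meq mineq s0 r10 r20).1.
  by apply: osqp_firm => // i; have [] := lux i.
- move=> [_ pP] [r10 r20 r30]; exists (scs_metric p mz mnz r1 r2 r3) => [|x Xx].
    exact: scs_metric_posdef.
  by apply: scs_nonexpansive => //; exact: pP.
Qed.
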